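(* Let $K$ be a non-empty compact Hausdorff topological space and let $X$ be a non-zero Banach space. (a) If $K'=\emptyset$ (equivalently, if $K$ is finite), then $C(K,X)$ has the weak-DD2P if and only if $X$ has the weak-DD2P. (b) If $K'$ is non-empty and finite, then $C(K,X)$ has the weak-DD2P if and only if $X$ is infinite-dimensional. (c) If $K'$ is infinite (equivalently, $K''\neq\emptyset$), then $C(K,X)$ always has the weak-DD2P.
   Context: $C(K,X)$ is the Banach space of continuous functions $K\to X$ with the supremum norm. For a topological space $V$, $V'$ denotes the set of cluster (accumulation) points of $V$, and $K''=(K')'$. A Banach space $Z$ (real or complex) with closed unit ball $B_Z$ has the weak-DD2P if for every non-empty relatively weakly open subset $W$ of $B_Z$ there exists $z\in W$ such that $\sup_{y\in V}\|z-y\|=2$ for every relatively weakly open subset $V$ of $B_Z$ with $z\in V$. *)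

(* Defs.v *)
From HB Require Import structures.
From mathcomp Require Import all_boot all_order all_algebra.
From mathcomp Require Import complex.
From mathcomp Require Import all_classical all_reals topology normedtype.

Set Implicit Arguments.
Unset Strict Implicit.
Unset Printing Implicit Defensive.
Import Order.TTheory GRing.Theory Num.Theory.
Import numFieldNormedType.Exports.
Local Open Scope classical_set_scope.
Local Open Scope ring_scope.

Inductive scalars := RealScalars | ComplexScalars.

Definition scalar_field (R : realType) (s : scalars) : numFieldType :=
  match s with
  | RealScalars => R
  | ComplexScalars => complex R
  end.

(* Norms over [scalar_field R s] take values in that field, where they are
   nonnegative reals; [complex R] is only partially ordered, but an upper bound
   of a non-empty set of reals is itself real, so [supremums] computes the
   usual real suprema in both cases. *)
Lemma scalar_supremums (R : realType) (s : scalars)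
    (A : set (scalar_field R s)) (M : scalar_field R s) :
  A !=set0 -> A `<=` [set x | 0 <= x] -> ubound A M -> supremums A !=set0.
Proof.
case: s A M => /= A M A0 Age0 AM.
  exists (sup A); have hs : has_sup A by split => //; exists M.
  split=> [x Ax|u Au]; first by apply: ub_le_sup => //; case: hs.
  exact: ge_sup.
pose re := @complex.Re R; pose B : set R := re @` A.
have realE x : 0 <= x -> x = real_complex R (re x).
  by move=> x0; rewrite [RHS]RRe_real// ger0_real.
have Bsup : has_sup B.
  split; first by case: A0 => a Aa; exists (re a), a.
  by exists (re M) => _ [a /AM + <-]; rewrite lecE => /andP[].
have [[a Aa] _] := (A0, Bsup).
exists (real_complex R (sup B)); split=> [x Ax|u Au].
  rewrite (realE x (Age0 _ Ax)) lecR; apply: ub_le_sup; first by case: Bsup.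
  by exists x.
rewrite (realE u) ?(le_trans (Age0 _ Aa)) ?Au// lecR.
apply: ge_sup; first by case: Bsup.
by move=> _ [x /Au + <-]; rewrite lecE => /andP[].
Qed.

(* The compactness proof only records that [K] is compact, which makes the
   supremum norm well defined. *)
Definition Cspace (K : topologicalType) of compact [set: K] :=
  fun X : topologicalType => continuousType K X.

Section Cspace_lmodule.
Context (F : numFieldType) (K : topologicalType) (cK : compact [set: K]).
Context (X : normedModType F).
Local Notation C := (Cspace cK X).

HB.instance Definition _ := Choice.copy C (continuousType K X).

Definition mkC (f : K -> X) (f_cts : continuous f) : C :=
  (mkcts f_cts : continuousType K X).

Lemma CspaceP (f g : C) : f =1 g -> f = g.
Proof. by move=> fg; exact/continuousEP. Qed.

Let zero_cts : continuous (fun _ : K => 0 : X).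
Proof. exact: cst_continuous. Qed.
Let opp_cts (f : C) : continuous (fun x => - f x).
Proof. by move=> x; apply: cvgN; exact: cts_fun. Qed.
Let add_cts (f g : C) : continuous (fun x => f x + g x).
Proof. by move=> x; apply: cvgD; exact: cts_fun. Qed.
Let scale_cts (a : F) (f : C) : continuous (fun x => a *: f x).
Proof. by move=> x; apply: cvgZl_tmp; exact: cts_fun. Qed.

Definition Cspace_zero : C := mkC zero_cts.
Definition Cspace_opp (f : C) : C := mkC (@opp_cts f).
Definition Cspace_add (f g : C) : C := mkC (@add_cts f g).
Definition Cspace_scale (a : F) (f : C) : C := mkC (@scale_cts a f).

Let addA : associative Cspace_add.
Proof. by move=> f g h; apply: CspaceP => x; exact: addrA. Qed.
Let addC : commutative Cspace_add.
Proof. by move=> f g; apply: CspaceP => x; exact: addrC. Qed.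
Let add0 : left_id Cspace_zero Cspace_add.
Proof. by move=> f; apply: CspaceP => x; exact: add0r. Qed.
Let addN : left_inverse Cspace_zero Cspace_opp Cspace_add.
Proof. by move=> f; apply: CspaceP => x; exact: addNr. Qed.

HB.instance Definition _ := GRing.isZmodule.Build C addA addC add0 addN.

Let scaleA a b (f : C) :
  Cspace_scale a (Cspace_scale b f) = Cspace_scale (a * b) f.
Proof. by apply: CspaceP => x; exact: scalerA. Qed.
Let scale1 : left_id 1 Cspace_scale.
Proof. by move=> f; apply: CspaceP => x; exact: scale1r. Qed.
Let scaleDr : right_distributive Cspace_scale +%R.
Proof. by move=> a f g; apply: CspaceP => x; exact: scalerDr. Qed.
Let scaleDl (f : C) : {morph Cspace_scale^~ f : a b / a + b}.
Proof. by move=> a b; apply: CspaceP => x; exact: scalerDl. Qed.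

HB.instance Definition _ :=
  GRing.Zmodule_isLmodule.Build F C scaleA scale1 scaleDr scaleDl.
End Cspace_lmodule.

Section Cspace_norm.
Context (R : realType) (s : scalars).
Context (K : topologicalType) (cK : compact [set: K]).
Local Notation F := (scalar_field R s).

Section norm.
Context (X : normedModType F).
Local Notation C := (Cspace cK X).

Definition Cspace_norm (f : C) : F :=
  supremum 0 [set `|f x| | x in [set: K]].

Lemma Cspace_bounded (f : C) : exists M, forall x, `|f x| <= M.
Proof.
have cov := (compact_near_coveringP [set: K]).1 cK F +oo
  (fun M x => `|f x| <= M) _.
have [x _|M0 [M0r M0P]] := cov _; last first.
  exists (M0 + 1) => x; apply: M0P => //.
  by rewrite ltrDl.
have fx : \forall x' \near x, `|f x'| < `|f x| + 1.
  have /cvgrPdist_lt/(_ 1 ltr01) := @cts_fun _ _ (f : continuousType K X) x.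
  apply: filterS => x' fx'.
  by rewrite -(subrK (f x) (f x')) addrC (le_lt_trans (ler_normD _ _))//
    ltrD2l distrC.
exists ([set x' | `|f x'| < `|f x| + 1], [set M | `|f x| + 1 < M]) => /=.
  by split => //; apply: nbhs_pinfty_gt; rewrite realD// normr_real.
by move=> [x' M] /= [+ xM] => /lt_trans/(_ xM)/ltW.
Qed.

Lemma Cspace_norm_isLub (f : C) : [set: K] !=set0 ->
  isLub [set `|f x| | x in [set: K]] (Cspace_norm f).
Proof.
move=> [k _]; rewrite /Cspace_norm /supremum ifF; last first.
  by apply/eqP/eqP/set0P; exists `|f k|, k.
case: xgetP => [y _ [yub ylb]|/forallNP none]; first by split.
have [M fM] := Cspace_bounded f.
exfalso; apply: none; apply: (@scalar_supremums _ _ _ M).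
- by exists `|f k|, k.
- by move=> _ [y _ <-] /=.
- by move=> _ [y _ <-].
Qed.

Lemma le_Cspace_norm (f : C) x : `|f x| <= Cspace_norm f.
Proof.
have [|ub _] := Cspace_norm_isLub f; first by exists x.
by apply: ub; exists x.
Qed.

Lemma Cspace_norm_le (f : C) M :
  0 <= M -> (forall x, `|f x| <= M) -> Cspace_norm f <= M.
Proof.
move=> M0 fM; have [K0|/set0P K0] := eqVneq [set: K] set0.
  by rewrite /Cspace_norm K0 image_set0 supremum0.
by have [_] := Cspace_norm_isLub f K0; apply => _ [x _ <-].
Qed.

Lemma Cspace_norm_ge0 (f : C) : 0 <= Cspace_norm f.
Proof.
have [K0|/set0P[x _]] := eqVneq [set: K] set0.
  by rewrite /Cspace_norm K0 image_set0 supremum0.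
exact: le_trans (le_Cspace_norm f x).
Qed.

Let normD (f g : C) : Cspace_norm (f + g) <= Cspace_norm f + Cspace_norm g.
Proof.
apply: Cspace_norm_le => [|x]; first by rewrite addr_ge0 ?Cspace_norm_ge0.
by rewrite (le_trans (ler_normD _ _))// lerD ?le_Cspace_norm.
Qed.

Let normZ_le (a : F) (f : C) : Cspace_norm (a *: f) <= `|a| * Cspace_norm f.
Proof.
apply: Cspace_norm_le => [|x]; first by rewrite mulr_ge0 ?Cspace_norm_ge0.
by rewrite normrZ ler_wpM2l ?le_Cspace_norm.
Qed.

Let norm_eq0 (f : C) : Cspace_norm f = 0 -> f = 0.
Proof.
move=> f0; apply: CspaceP => x; apply/eqP.
by rewrite -normr_le0 -f0 le_Cspace_norm.
Qed.

Let normZ (a : F) (f : C) : Cspace_norm (a *: f) = `|a| * Cspace_norm f.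
Proof.
apply/eqP; rewrite eq_le normZ_le/=; have [->|a0] := eqVneq a 0.
  by rewrite normr0 mul0r Cspace_norm_ge0.
rewrite mulrC -ler_pdivlMr ?normr_gt0// mulrC -normfV.
by rewrite (le_trans _ (normZ_le _ _))// scalerA mulVf// scale1r.
Qed.

HB.instance Definition _ :=
  Lmodule_isNormed.Build F C normD normZ norm_eq0.
End norm.

Section complete.
Context (X : completeNormedModType F).
Local Notation C := (Cspace cK X).

Lemma Cspace_normE (f : C) : `|f| = Cspace_norm f.
Proof. by []. Qed.

Let Cspace_complete (G : set_system C) : ProperFilter G -> cauchy G -> cvg G.
Proof.
move=> PG /cauchy_ballP Gc.
have Gc' e : 0 < e -> \forall f & g \near G, `|f - g| < e.
  by move=> e0; have := Gc e e0; apply: filterS => -[f g]; rewrite -ball_normE.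
have evalc x : cvg ((fun f : C => f x) @ G).
  apply: cauchy_cvg; apply/cauchy_ballP => e e0.
  rewrite near_map2; apply: filterS (Gc' e e0) => -[f g] /= fg.
  by rewrite -ball_normE/=; apply: le_lt_trans fg; exact: le_Cspace_norm (f - g) x.
pose l x := lim ((fun f : C => f x) @ G).
have unif (e : F) : 0 < e -> \forall f \near G, forall x, `|l x - (f : C) x| <= e.
  move=> e0; have e20 : 0 < e / 2 by rewrite divr_gt0.
  have [[A B] /= [GA GB] AB] := Gc' _ e20; apply: filterS GA => f Af x.
  have /cvgrPdist_lt/(_ _ e20) lG := evalc x.
  near G => g; rewrite [e]splitr -(subrKA (g x)).
  rewrite (le_trans (ler_normD _ _))// lerD//.
    by apply: ltW; near: g; exact: lG.
  have Bg : B g by near: g.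
  rewrite distrC (le_trans (le_Cspace_norm (f - g) x))//.
  by apply: ltW; exact: (AB (f, g)).
have l_cts : continuous l.
  move=> x; apply/cvgrPdist_le => e e0.
  have e30 : 0 < e / 3 by rewrite divr_gt0.
  near G => f; have lf : forall y, `|l y - f y| <= e / 3.
    by near: f; exact: unif.
  have /cvgrPdist_lt/(_ _ e30) := @cts_fun _ _ (f : continuousType K X) x.
  apply: filterS => y /ltW fxy.
  have -> : l x - l y = (l x - f x) + (f x - f y) - (l y - f y).
    by rewrite opprB !addrA !subrK.
  have -> : e = e / 3 + e / 3 + e / 3.
    by rewrite -mulr2n -mulrSr -[RHS]mulr_natr divfK ?pnatr_eq0.
  by rewrite (le_trans (ler_normB _ _))// lerD// (le_trans (ler_normD _ _))// lerD.
apply/cvg_ex; exists (mkC cK l_cts).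
apply/cvgrPdist_le => e e0; near=> f; apply: Cspace_norm_le; first exact: ltW.
by near: f; exact: unif.
Unshelve. all: by end_near. Qed.

HB.instance Definition _ := Uniform_isComplete.Build C Cspace_complete.
End complete.
End Cspace_norm.

Definition finite_dimensional (F : numFieldType) (X : lmodType F) :=
  exists (n : nat) (e : 'I_n -> X),
    forall x : X, exists a : 'I_n -> F, x = \sum_(i < n) a i *: e i.

(* The set of cluster points of [V], as a topological space with the topology
   induced by [T]. *)
Definition cluster_points (T : topologicalType) (V : set T) : set T :=
  V `&` limit_point V.

Section weakDD2P.
Context (F : numFieldType).

Definition dual (Z : normedModType F) :=
  {phi : {linear Z -> F^o} | continuous phi}.

Definition weak_space (Z : normedModType F) : Type := Z.

HB.instance Definition _ (Z : normedModType F) :=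
  Topological.copy (weak_space Z) (sup_topology (fun phi : dual Z =>
    Topological.class (initial_topology (sval phi : Z -> F^o)))).

Definition closed_unit_ball (Z : normedModType F) : set Z := [set z | `|z| <= 1].

Definition rel_weakly_open (Z : normedModType F) (W : set Z) :=
  exists2 U : set (weak_space Z), open U & W = U `&` @closed_unit_ball Z.

Definition weakDD2P (Z : completeNormedModType F) :=
  forall W : set Z, rel_weakly_open W -> W !=set0 ->
  exists2 z, W z &
    forall V : set Z, rel_weakly_open V -> V z ->
      isLub [set `|z - y| | y in V] 2.
End weakDD2P.

(* Main.v *)
Require Import Defs.
From HB Require Import structures.
From mathcomp Require Import all_boot all_order all_algebra.
From mathcomp Require Import finmap complex.
From mathcomp Require Import all_classical all_reals topology normedtype.
Import Order.TTheory GRing.Theory Num.Theory.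
Import numFieldNormedType.Exports.
Local Open Scope classical_set_scope.
Local Open Scope ring_scope.

(** Call a point [z] of the unit ball [B] a super Delta-point if every weak
    neighbourhood of [z] contains points of [B] at distance almost 2 from [z].
    The weak-DD2P says that every non-empty relatively weakly open subset of
    [B] contains such a point.

    Positive direction.  The main tool is [small_bump]: given infinitely many
    points of [K], disjointly supported bumps [h] can be placed at arbitrarily
    many of them.  For a bounded functional [phi] the numbers [phi (h u)] have
    absolute sum at most [|phi| |u|], since the signs can be absorbed in the
    bumps; so for a fixed [u] some [h u] is weakly as small as desired.  With
    [u = -2 z] this shows that [z] is a super Delta-point as soon as it attains
    norm 1 at a cluster point [k] of [K]: there are infinitely many points near
    [k] where [|z|] is almost 1, and [z - 2 h z] stays in the ball.
    It remains to find such [z] weakly close to a given [f].  If [K] has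
    infinitely many cluster points, bend [f] towards a fixed unit vector [y] at
    one of them: [f + h (y - f)] is weakly close to [f] by [small_bump].  If
    there is only one cluster point [k] at hand but [X] is infinite-dimensional,
    take a bump [h] where [f] is nearly constant and a non-zero [x] killed by
    the finitely many functionals [x |-> phi (h x)]; moving [f k] along [x]
    until it has norm 1 changes [f] only a little in the weak topology.

    Negative direction.  If [X] is finite-dimensional and [K] has finitely many
    cluster points, then the functions of norm less than 1/2 at all cluster
    points form a weakly open set, because norm and weak topology agree on [X].
    For [z] in this set, [|z| >= 1/2] can hold at finitely many points only,
    and prescribing [y] to be within 1 of [z] at those keeps [|z - y|] at most
    3/2.

    If [K] is finite, [C(K,X)] is a finite sup-normed power of [X]: replacing
    one coordinate by a super Delta-point gives a super Delta-point, and
    conversely a super Delta-point has a coordinate which is one, as finitely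
    many bounds below 2 have a maximum below 2. *)

Set Implicit Arguments.
Unset Strict Implicit.
Unset Printing Implicit Defensive.

(** * Suprema and positive numbers *)

(** The order of the scalars is partial in the complex case; what makes this
    work is that upper bounds of non-negative numbers are real, hence
    comparable with [l]. *)
Lemma isLub_eps (F : numFieldType) (A : set F) (l : F) :
  A !=set0 -> A `<=` [set x | 0 <= x] -> ubound A l ->
  isLub A l <-> forall e, 0 < e -> exists2 x, A x & l - e < x.
Proof.
move=> [a Aa] A0 Al; have l0 : 0 <= l by rewrite (le_trans (A0 _ Aa)) ?Al.
split=> [[_ lub] e e0|close].
  apply: contrapT => none; have : l <= l - e.
    apply: lub => x Ax; have xr : x \is Num.real by rewrite ger0_real ?A0.
    have ler : l - e \is Num.real by rewrite rpredB ?ger0_real// ltW.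
    by case: (real_leP xr ler) => // ?; exfalso; apply: none; exists x.
  by rewrite lerDl oppr_ge0 => /(lt_le_trans e0); rewrite ltxx.
split=> // u Au; have u0 : 0 <= u by rewrite (le_trans (A0 _ Aa)) ?Au.
case: (real_leP (ger0_real l0) (ger0_real u0)) => // ul.
have [|x Ax] := close (l - u); first by rewrite subr_gt0.
by rewrite subKr => /lt_le_trans/(_ (Au _ Ax)); rewrite ltxx.
Qed.

Lemma pos_lower_bound (F : numFieldType) (I : eqType) (r : seq I) (d : I -> F) :
  (forall i, 0 < d i) -> exists2 e, 0 < e & forall i, i \in r -> e <= d i.
Proof.
move=> d0; elim: r => [|i r [e e0 IH]]; first by exists 1.
have [ei|ie] := real_leP (gtr0_real e0) (gtr0_real (d0 i)).
  by exists e => // j; rewrite inE => /predU1P[->//|/IH].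
exists (d i) => // j; rewrite inE => /predU1P[->//|/IH].
exact/le_trans/ltW.
Qed.

(** * Limit points and finite families of neighbourhoods *)

(** The sets containing all but finitely many points of [A] form a proper
    filter; a point where it clusters cannot be isolated from [A]. *)
Lemma compact_limit_point (T : topologicalType) (A : set T) :
  compact [set: T] -> infinite_set A -> exists p, limit_point A p.
Proof.
move=> cT infA; pose G := [set B | finite_set (A `\` B)].
have PG : ProperFilter G.
  split; first by rewrite /G/= setD0.
  split; rewrite /G /=.
  - by rewrite setDT.
  - by move=> P Q /= finP finQ; rewrite setDIr finite_setU.
  - by move=> P Q PQ; apply: sub_finite_set; exact: setDS.
have [|p [_ clp]] := cT G PG; first by rewrite /G/= setDT.
exists p => U nU.
have [|x [[Ax xp] Ux]] := clp (A `\ p) U _ nU.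
  by rewrite /G/= setDD; apply: (@sub_finite_set _ _ [set p]) => // x [].
by exists x; split => //; exact/eqP.
Qed.

(** Finite sets are closed, so finitely many points other than [p] can be cut
    out of a neighbourhood of [p]. *)
Lemma limit_point_infinite (T : topologicalType) (A U : set T) p :
  accessible_space T -> limit_point A p -> nbhs p U -> infinite_set (A `&` U).
Proof.
move=> T1 Ap nU finAU.
have clS : closed ((A `&` U) `\ p).
  by apply: (accessible_finite_set_closed.1 T1); apply: finite_setD.
have [|x [xp Ax [Ux]]] := Ap (U `&` ~` ((A `&` U) `\ p)).
  apply: filterI => //; apply: open_nbhs_nbhs; split; first exact: closed_openC.
  by case=> _ /=; apply.
by apply; split=> //; exact/eqP.
Qed.

Lemma disjoint_nbhs (T : topologicalType) N (t : 'I_N -> T) :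
  hausdorff_space T -> injective t ->
  exists U : 'I_N -> set T, (forall i, nbhs (t i) (U i)) /\
    (forall i j, i != j -> U i `&` U j = set0).
Proof.
rewrite open_hausdorff => hT tI.
have sep (ij : 'I_N * 'I_N) : exists AB : set T * set T, ij.1 != ij.2 ->
    [/\ nbhs (t ij.1) AB.1, nbhs (t ij.2) AB.2 & AB.1 `&` AB.2 = set0].
  case: ij => i j /=; have [->|ij] := eqVneq i j; first by exists (set0, set0).
  have [|AB [iA jB] [oA oB /eqP AB0]] := hT (t i) (t j).
    by apply: contra ij => /eqP/tI ->.
  exists AB => _; split => //; apply: open_nbhs_nbhs; split => //.
    exact: set_mem iA.
  exact: set_mem jB.
have {sep}[AB ABP] := choice sep.
exists (fun i =>
  [set x | forall j, j != i -> (AB (i, j)).1 x /\ (AB (j, i)).2 x]).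
split=> [i|i j ij].
  apply: filter_forall => j; have [->|ji] := eqVneq j i.
    exact: filterE.
  have [|ni _ _] := ABP (i, j); first by rewrite eq_sym.
  have [_ nj _] := ABP (j, i) ji.
  by apply: filterS2 ni nj => x ? ? _.
rewrite -subset0 => x [/= xi xj].
have [_ _ AB0] := ABP (i, j) ij.
suff : set0 x by []; rewrite -AB0.
by split; [case: (xi j) => //; rewrite eq_sym|case: (xj i)].
Qed.

Lemma near_finite (T : topologicalType) (I : choiceType) (S : set I) (x : T)
    (U : I -> set T) :
  finite_set S -> (forall i, S i -> nbhs x (U i)) ->
  nbhs x [set y | forall i, S i -> U i y].
Proof.
move=> /finite_fsetP[r ->] nU; exact: (filter_bigI (nbhs_filter x) nU).
Qed.

Lemma open_finite (T : topologicalType) (I : choiceType) (S : set I)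
    (U : I -> set T) :
  finite_set S -> (forall i, S i -> open (U i)) ->
  open [set y | forall i, S i -> U i y].
Proof.
move=> finS oU; rewrite openE => x Ux; apply: near_finite => // i Si.
by apply: open_nbhs_nbhs; split; [exact: oU|exact: Ux].
Qed.

(** * Real and complex scalars *)

(** Real-variable arguments (Archimedes, the intermediate value theorem,
    Urysohn functions) are carried out in [R] and transported along [iota], for
    both kinds of scalars at once. *)
Lemma scalar_embedding (R : realType) (s : scalars) :
  exists iota : {rmorphism R -> scalar_field R s},
    [/\ forall x y, (iota x <= iota y) = (x <= y),
        forall z, 0 <= z -> exists x, z = iota x &
        forall x, `|iota x| = iota `|x| ].
Proof.
case: s => /=; first by exists idfun; split => // z _; exists z.
exists (real_complex R); split=> [x y|z z0|x]; first exact: lecR.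
  by exists (complex.Re z); rewrite [RHS]RRe_real// ger0_real.
by rewrite normc_def/= expr0n addr0 sqrtr_sqr.
Qed.

Lemma scalar_archi (R : realType) (s : scalars) (z : scalar_field R s) :
  0 <= z -> exists n : nat, z < n%:R.
Proof.
have [iota [iota_le iota_onto _]] := scalar_embedding R s.
move=> /iota_onto[x ->]; exists (Num.bound `|x|).
rewrite -(rmorph_nat iota) lt_neqAle iota_le.
have xb : x < (Num.bound `|x|)%:R.
  by rewrite (le_lt_trans (ler_norm x))// archi_boundP.
rewrite (ltW xb) andbT; apply: contraTN xb => /eqP/(fmorph_inj iota) <-.
by rewrite ltxx.
Qed.

Lemma real_seq_complete (R : realType) (a : nat -> R) :
  (forall e : R, 0 < e -> exists N, forall m n, (N <= m)%N -> (N <= n)%N ->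
    `|a m - a n| < e) ->
  exists l, forall e : R, 0 < e ->
    exists N, forall n, (N <= n)%N -> `|a n - l| < e.
Proof.
move=> ac; have : cvg (a @ \oo).
  apply: cauchy_cvg; apply/cauchy_exP => e e0.
  have [N NP] := ac e e0; exists (a N); exists N => //= n /= Nn.
  by rewrite -ball_normE/=; exact: NP.
move=> /cvg_ex[l /cvgrPdist_lt al]; exists l => e e0.
have [N _ NP] := al e e0; exists N => n Nn; rewrite distrC; exact: NP.
Qed.

(** In the complex case, real and imaginary parts converge separately. *)
Lemma scalar_seq_complete (R : realType) (s : scalars)
    (a : nat -> scalar_field R s) :
  (forall e : scalar_field R s, 0 < e ->
    exists N, forall m n, (N <= m)%N -> (N <= n)%N ->
    `|a m - a n| < e) ->
  exists l, forall e : scalar_field R s, 0 < e ->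
    exists N, forall n, (N <= n)%N -> `|a n - l| < e.
Proof.
case: s a => /= a; first exact: real_seq_complete.
move=> ac.
have part (p : complex R -> R) : (forall x y, p (x - y) = p x - p y) ->
    (forall z, real_complex R `|p z| <= `|z|) ->
    exists l, forall e : R, 0 < e -> exists N, forall n, (N <= n)%N ->
      `|p (a n) - l| < e.
  move=> pB ple; apply: real_seq_complete => e e0.
  have [|N NP] := ac (real_complex R e); first by rewrite ltcR.
  exists N => m n Nm Nn; rewrite -pB -ltcR.
  exact: le_lt_trans (ple _) (NP _ _ Nm Nn).
have [reE imE] : (forall z, (real_complex R `|complex.Re z|) <= `|z|) /\
    (forall z, (real_complex R `|complex.Im z|) <= `|z|).
  split=> z; first exact: normc_ge_Re.
  by rewrite normc_def lecR -sqrtr_sqr ler_wsqrtr// lerDr sqr_ge0.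
have [|p pP] := part (@complex.Re R) _ reE; first by move=> [? ?] [? ?].
have [|q qP] := part (@complex.Im R) _ imE; first by move=> [? ?] [? ?].
exists (Complex p q) => e e0.
have eE : e = real_complex R (complex.Re e) by rewrite RRe_real// gtr0_real.
rewrite eE ltcR in e0.
have e20 : 0 < complex.Re e / 2 by rewrite divr_gt0.
have [N1 NP1] := pP _ e20; have [N2 NP2] := qP _ e20.
exists (maxn N1 N2) => n; rewrite geq_max => /andP[/NP1 ltp /NP2 ltq].
rewrite eE (splitr (complex.Re e)) [a n - _]complexE.
rewrite (le_lt_trans (ler_normD _ _))//.
have normR (x : R) : `|real_complex R x| = real_complex R `|x|.
  by rewrite normc_def/= expr0n addr0 sqrtr_sqr.
rewrite rmorphD ltrD ?normrM ?normR//.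
- by move: ltp; rewrite -ltcR; case: (a n).
- rewrite normc_def/= expr0n expr1n add0r sqrtr1 mul1r.
  by move: ltq; rewrite -ltcR; case: (a n).
Qed.

(** Along the ray [t |-> a + t x] the norm starts at a value at most 1 and
    exceeds 1 once [t >= 2 / |x|], so the intermediate value theorem applies to
    this real function of [t]. *)
Lemma unit_shift (R : realType) (s : scalars)
    (X : normedModType (scalar_field R s)) (a x : X) :
  `|a| <= 1 -> x != 0 -> exists c : scalar_field R s, `|a + c *: x| = 1.
Proof.
move=> a1 x0; have [iota [iota_le iota_onto iota_norm]] := scalar_embedding R s.
have x_gt0 : 0 < `|x| by rewrite normr_gt0.
have [g gP] := choice (fun t => iota_onto _ (normr_ge0 (a + iota t *: x))).
have [q qP] : exists q, `|x| = iota q by exact: iota_onto.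
have [T TP] : exists T, 2 / `|x| = iota T.
  by apply: iota_onto; rewrite divr_ge0.
have T0 : 0 <= T by rewrite -iota_le -TP rmorph0 divr_ge0.
have q0 : 0 < q.
  rewrite lt_neqAle -iota_le rmorph0 -qP normr_ge0 andbT eq_sym.
  by rewrite -(inj_eq (fmorph_inj iota)) rmorph0 -qP normr_eq0.
have g_lip t u : `|g t - g u| <= `|t - u| * q.
  rewrite -iota_le rmorphM -qP -!iota_norm -normrZ rmorphB -!gP.
  rewrite (le_trans (ler_dist_dist _ _))//.
  by rewrite opprD addrACA subrr add0r -scalerBl -rmorphB.
have g_cts : continuous g.
  move=> t; apply/cvgrPdist_lt => e e0.
  have : nbhs t (ball t (e / q)) by apply: nbhsx_ballx; rewrite divr_gt0.
  apply: filterS => u; rewrite -ball_normE/= => tu.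
  by rewrite (le_lt_trans (g_lip _ _))// -ltr_pdivlMr.
have [||c _ gc] := @IVT R g 0 T 1 T0; first exact: continuous_subspaceT.
  rewrite ge_min le_max -(iota_le (g 0)) -(iota_le 1 (g T)) -!gP.
  rewrite rmorph1 rmorph0 scale0r addr0 a1/=.
  apply/orP; right; rewrite -TP -(lerD2l `|a|).
  apply: (@le_trans _ _ `|(2 / `|x|) *: x|).
    by rewrite normrZ ger0_norm ?divr_ge0// divfK ?gt_eqF// -[2]/(1 + 1) lerD2r.
  rewrite -[X in `|X| <= _](addrK a) [X in `|X - _|]addrC [leRHS]addrC.
  exact: ler_normB.
by exists (iota c); rewrite gP gc rmorph1.
Qed.

(** * The weak topology *)

Lemma dual_bounded (F : numFieldType) (Z : normedModType F) (phi : dual Z) :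
  exists M, 0 <= M /\ forall z, `|sval phi z| <= M * `|z|.
Proof.
case: phi => phi /= /linear_bounded_continuous/linear_boundedP.
move=> /pinfty_ex_gt0[M M0 MP].
by exists M; split => //; exact: ltW.
Qed.

Lemma linear_bounded_cts (F : numFieldType) (V W : normedModType F)
    (f : {linear V -> W}) (M : F) :
  0 <= M -> (forall z, `|f z| <= M * `|z|) -> continuous f.
Proof.
move=> M0 fM; apply/linear_bounded_continuous/linear_boundedP.
near=> r => z; rewrite (le_trans (fM z))// ler_wpM2r//.
near: r; apply: nbhs_pinfty_ge; exact: ger0_real.
Unshelve. all: by end_near. Qed.

Definition comp_dual (F : numFieldType) (V W : normedModType F)
    (L : {linear V -> W}) (cL : continuous L) (phi : dual W) : dual V :=
  exist (fun psi : {linear V -> F^o} => continuous psi)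
    (sval phi \o L : {linear V -> F^o})
    (fun z => continuous_comp (@cL z) (svalP phi (L z))).

(** The basic neighbourhoods of the weak topology; the family of functionals is
    indexed by an ordinal so that one can sum over it. *)
Definition weakly_near (F : numFieldType) (Z : normedModType F)
    (z : Z) (U : set Z) :=
  exists (n : nat) (phi : 'I_n -> dual Z), exists2 e : F, 0 < e &
    forall y, (forall i, `|sval (phi i) (y - z)| < e) -> U y.

Lemma weakly_nearI (F : numFieldType) (Z : normedModType F)
    (z : Z) (U V : set Z) :
  weakly_near z U -> weakly_near z V -> weakly_near z (U `&` V).
Proof.
move=> [n [phi [d d0 dU]]] [m [psi [e e0 eV]]].
exists (n + m)%N, (fun i =>
  match fintype.split i with inl j => phi j | inr j => psi j end).
have [r r0 rP] : exists2 r, 0 < r & r <= d /\ r <= e.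
  have [|r r0 rP] := @pos_lower_bound F bool [:: true; false]
    (fun b => if b then d else e); first by case.
  by exists r => //; split; [exact: (rP true)|exact: (rP false)].
exists r => // y yr; split.
  apply: dU => i; have := yr (lshift m i).
  by rewrite (unsplitK (inl i)) => /lt_le_trans; apply; case: rP.
apply: eV => i; have := yr (rshift n i).
by rewrite (unsplitK (inr i)) => /lt_le_trans; apply; case: rP.
Qed.

Lemma weakly_nearS (F : numFieldType) (Z : normedModType F)
    (z : Z) (U V : set Z) :
  U `<=` V -> weakly_near z U -> weakly_near z V.
Proof.
by move=> UV [n [phi [e e0 eU]]]; exists n, phi, e => // y /eU /UV.
Qed.

Lemma weakly_nearT (F : numFieldType) (Z : normedModType F) (z : Z) :
  weakly_near z [set: Z].
Proof. have phi (i : 'I_0) : dual Z by case: i => i; rewrite ltn0.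
by exists 0%N, phi, 1. Qed.

(** The basic neighbourhoods form a filter, so the universal property of
    the supremum topology reduces both inclusions to a single functional. *)
Lemma weak_nbhsP (F : numFieldType) (Z : normedModType F) (z : Z) (U : set Z) :
  nbhs (z : weak_space Z) U <-> weakly_near z U.
Proof.
split=> [zU|[n [phi [e e0 eU]]]].
  have FN : Filter (weakly_near z).
    by split; [exact: weakly_nearT|exact: weakly_nearI|exact: weakly_nearS].
  apply: (proj2 (@cvg_sup Z _ (fun phi : dual Z =>
    Topological.class (initial_topology (sval phi : Z -> F^o)))
    (weakly_near z) z FN)) zU.
  move=> phi A [_ [[B oB <-] Bz] BA].
  move: oB; rewrite openE => /(_ _ Bz).
  rewrite /interior/= => /nbhs_ballP[e /= e0 eB].
  exists 1%N, (fun=> phi), e => // y /(_ ord0) phiyz.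
  apply: BA => /=; apply: eB; rewrite -ball_normE/= distrC -linearB.
  exact: phiyz.
apply: (@filterS _ (nbhs (z : weak_space Z)) _ _ _ eU).
apply: (@filter_forall (weak_space Z) 'I_n
  (fun i => [set y : Z | `|sval (phi i) (y - z)| < e])
  (nbhs (z : weak_space Z)) (nbhs_filter (z : weak_space Z))) => i.
have := proj1 (@cvg_sup Z _ (fun phi : dual Z =>
    Topological.class (initial_topology (sval phi : Z -> F^o)))
    (nbhs (z : weak_space Z)) z
    (nbhs_filter (z : weak_space Z))) (fun A nA => nA) (phi i)
  [set y | `|sval (phi i) (y - z)| < e].
apply; exists (sval (phi i) @^-1` (ball (sval (phi i) z) e)); split.
- by exists (ball (sval (phi i) z) e) => //; exact: ball_open.
- exact: (@ballxx _ _ (sval (phi i) z) e e0).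
- by move=> y; rewrite /= -ball_normE/= distrC -linearB.
Qed.

(** Stated for affine maps because the embeddings of [X] into the space of
    functions used below fix a function off one point and are not linear. *)
Lemma affine_weak_continuous (F : numFieldType) (V W : normedModType F)
    (T : V -> W) (L : {linear V -> W}) :
  continuous L -> (forall y z, T y - T z = L (y - z)) ->
  continuous (T : weak_space V -> weak_space W).
Proof.
move=> cL TL z U /weak_nbhsP[n [phi [e e0 eU]]].
apply/weak_nbhsP; exists n, (fun i => comp_dual cL (phi i)), e => // y ye.
by apply: eU => i; rewrite TL; exact: ye.
Qed.

(** * Super Delta-points *)

(** The upper bound 2 on the distance being automatic in the ball, only the
    approximation from below is recorded. *)
Definition super_delta (F : numFieldType) (Z : normedModType F) (z : Z) :=
  forall U, nbhs (z : weak_space Z) U -> forall e, 0 < e ->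
    exists y, [/\ U y, `|y| <= 1 & 2 - e < `|z - y|].

(** Every weak neighbourhood contains a weakly open one, and bounds on
    [|z - y|] by 2 come from the triangle inequality; so the supremum condition
    becomes [super_delta]. *)
Lemma weakDD2PE (F : numFieldType) (Z : completeNormedModType F) :
  weakDD2P Z <-> forall (U : set (weak_space Z)) (f : Z), open U -> U f ->
    `|f| <= 1 -> exists z : Z, [/\ U z, `|z| <= 1 & super_delta z].
Proof.
have lubP (V : set Z) (z : Z) : rel_weakly_open V -> V z ->
    isLub [set `|z - y| | y in V] 2 <->
    forall e, 0 < e -> exists2 y, V y & 2 - e < `|z - y|.
  move=> [U _ VU] Vz; have ball w : V w -> `|w| <= 1 by rewrite VU => -[].
  have := @isLub_eps _ [set `|z - y| | y in V] 2.
  case.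
  - by exists `|z - z|, z.
  - by move=> _ [y _ <-] /=.
  - move=> _ [y Vy <-]; rewrite (le_trans (ler_normB _ _))//.
    by rewrite -[2]/(1 + 1) lerD// ball.
  move=> lub1 lub2; split=> [/lub1 H e /H[_ [y Vy <-]] ?|H]; first by exists y.
  by apply: lub2 => e /H[y Vy ?]; exists `|z - y| => //; exists y.
split=> [dd U f oU Uf f1|dd W [U oU ->] [f [Uf f1]]].
  have [||z [Uz z1] zP] := dd (U `&` @closed_unit_ball F Z).
  - by exists U.
  - by exists f.
  exists z; split=> // V zV e e0.
  pose O : set (weak_space Z) := interior (V : set (weak_space Z)).
  have rV : rel_weakly_open (O `&` @closed_unit_ball F Z).
    by exists O => //; exact: open_interior.
  have Vz : (O `&` @closed_unit_ball F Z) z by [].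
  have [y [Vy y1] ey] := (lubP _ _ rV Vz).1 (zP _ rV Vz) _ e0.
  by exists y; split => //; exact: interior_subset Vy.
have [z [Uz z1 zP]] := dd U f oU Uf f1.
exists z => // V rV Vz; apply/(lubP _ _ rV Vz) => e e0.
case: rV Vz => O oO -> [Oz _].
have [|y [Oy y1 ey]] := zP O _ e e0; last by exists y.
by apply: open_nbhs_nbhs.
Qed.

(** * Finite and infinite dimension *)

(** Coordinates with respect to a finite independent family are bounded.  By
    induction it is enough that the last vector [v] has positive distance to the
    span of the others: otherwise combinations of these converge to [v], their
    coefficients are Cauchy by the bound already known, and the limits
    of the coefficients express [v] through the other vectors. *)
Lemma independent_coord_bound (R : realType) (s : scalars)
    (X : normedModType (scalar_field R s)) n (e : 'I_n -> X) :
  (forall a : 'I_n -> scalar_field R s,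
    \sum_(i < n) a i *: e i = 0 -> forall i, a i = 0) ->
  exists2 C : scalar_field R s, 0 <= C &
    forall (a : 'I_n -> scalar_field R s) i,
      `|a i| <= C * `|\sum_(i < n) a i *: e i|.
Proof.
set F := scalar_field R s.
elim: n e => [|n IH] e indep; first by exists 0 => // a [].
pose w (i : 'I_n) := e (widen_ord (leqnSn n) i); pose v := e ord_max.
pose ext (a : 'I_n -> F) (b : F) (i : 'I_n.+1) :=
  if unlift ord_max i is Some j then a j else b.
have widenE (j : 'I_n) : widen_ord (leqnSn n) j = lift ord_max j.
  by apply: val_inj; rewrite /= /bump leqNgt ltn_ord.
have sumE a b : \sum_(i < n.+1) ext a b i *: e i =
    \sum_(i < n) a i *: w i + b *: v.
  rewrite big_ord_recr/=; congr (_ + _); last by rewrite /ext unlift_none.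
  by apply: eq_bigr => i _; rewrite /ext /w widenE liftK.
have [C C0 CP] : exists2 C : F, 0 <= C & forall (a : 'I_n -> F) i,
    `|a i| <= C * `|\sum_(i < n) a i *: w i|.
  apply: IH => a aw i; have := indep (ext a 0) _ (lift ord_max i).
  by rewrite /ext liftK; apply; rewrite sumE aw scale0r addr0.
have [d d0 dP] : exists2 d : F, 0 < d &
    forall b : 'I_n -> F, d <= `|v - \sum_(i < n) b i *: w i|.
  apply: contrapT => nod.
  have close (k : nat) : exists b : 'I_n -> F,
      `|v - \sum_(i < n) b i *: w i| < k.+1%:R^-1.
    apply: contrapT => nob; apply: nod; exists k.+1%:R^-1 => [|b].
      by rewrite invr_gt0 ltr0n.
    rewrite real_leNgt ?normr_real ?ger0_real ?invr_ge0//.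
    by apply/negP => ?; apply: nob; exists b.
  have [b bP] := choice close.
  have small (r : F) : 0 < r -> exists N, forall m, (N <= m)%N -> m.+1%:R^-1 < r.
    move=> r0; have rV0 : 0 < r^-1 by rewrite invr_gt0.
    have [N NP] := scalar_archi (ltW rV0); exists N => m Nm.
    rewrite -[ltRHS]invrK ltf_pV2 ?posrE ?ltr0n// (lt_le_trans NP)// ler_nat.
    exact: leqW.
  have bc i (r : F) : 0 < r -> exists N, forall m k, (N <= m)%N -> (N <= k)%N ->
      `|b m i - b k i| < r.
    move=> r0; pose q := r / 2 / (C + 1).
    have C1 : 0 < C + 1 by rewrite ltr_wpDl.
    have [|N NP] := small q; first by rewrite !divr_gt0.
    exists N => m k Nm Nk.
    rewrite (le_lt_trans (CP (fun i => b m i - b k i) i))//.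
    have -> : \sum_(j < n) (b m j - b k j) *: w j =
        (v - \sum_(j < n) b k j *: w j) - (v - \sum_(j < n) b m j *: w j).
      rewrite opprB addrC addrA subrK -sumrB.
      by apply: eq_bigr => j _; rewrite scalerBl.
    apply: (@le_lt_trans _ _ (C * (q + q))).
      rewrite ler_wpM2l// (le_trans (ler_normB _ _))// lerD//.
        by rewrite (le_trans (ltW (bP k)))// ltW// NP.
      by rewrite (le_trans (ltW (bP m)))// ltW// NP.
    rewrite /q -mulrDl -splitr mulrCA gtr_pMr// ltr_pdivrMr// mul1r.
    by rewrite ltrDl.
  have [l lP] := choice (fun i => scalar_seq_complete (bc i)).
  have vE : v = \sum_(i < n) l i *: w i.
    apply: contrapT => /eqP; rewrite -subr_eq0 -normr_gt0.
    set D := `|_| => D0; pose S := 1 + \sum_(i < n) `|w i|.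
    have S0 : 0 < S by rewrite ltr_pwDl// sumr_ge0.
    have [N1 NP1] : exists N, forall m, (N <= m)%N ->
        forall i, `|b m i - l i| < D / 2 / S.
      have : \forall m \near \oo, forall i, `|b m i - l i| < D / 2 / S.
        apply: filter_forall => i.
        have [|N NP] := lP i (D / 2 / S); first by rewrite !divr_gt0.
        by exists N.
      by move=> [N _ NP]; exists N => m /NP.
    have [|N2 NP2] := small (D / 2); first by rewrite divr_gt0.
    pose m := maxn N1 N2; suff : D < D by rewrite ltxx.
    rewrite {1}/D -(subrKA (\sum_(i < n) b m i *: w i)).
    rewrite (le_lt_trans (ler_normD _ _))//.
    rewrite [ltRHS]splitr ltr_leD//.
      by rewrite (lt_trans (bP m))// NP2// leq_maxr.
    rewrite -sumrB (le_trans (ler_norm_sum _ _ _))//.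
    apply: (@le_trans _ _ (\sum_(i < n) D / 2 / S * `|w i|)).
      apply: ler_sum => i _; rewrite -scalerBl normrZ ler_wpM2r//.
      by rewrite ltW// NP1// leq_maxl.
    rewrite -mulr_sumr -mulrA ger_pMr ?divr_gt0// mulrC ler_pdivrMr// mul1r.
    by rewrite /S lerDr.
  have := indep (ext l (-1)) _ ord_max.
  rewrite /ext unlift_none sumE -vE scaleN1r subrr => /(_ erefl)/eqP.
  by rewrite oppr_eq0 oner_eq0.
exists (d^-1 + C * (1 + d^-1 * `|v|)) => [|a i].
  by rewrite addr_ge0 ?mulr_ge0 ?addr_ge0 ?mulr_ge0 ?invr_ge0// ltW.
set y := \sum_(i < n.+1) _.
have lastP : `|a ord_max| <= d^-1 * `|y|.
  have [->|am] := eqVneq (a ord_max) 0.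
    by rewrite normr0 mulr_ge0// invr_ge0 ltW.
  have -> : y = a ord_max *:
      (v - \sum_(i < n) (- (a ord_max)^-1 * a (lift ord_max i)) *: w i).
    rewrite scalerBr scaler_sumr -sumrN /y big_ord_recr/= addrC; congr (_ + _).
    apply: eq_bigr => j _.
    rewrite scalerA mulrA mulrN mulfV// mulN1r scaleNr opprK.
    by rewrite /w widenE.
  rewrite normrZ mulrCA ler_peMr// mulrC ler_pdivlMr// mul1r; exact: dP.
case: (unliftP ord_max i) => [j ->|->]; last first.
  rewrite (le_trans lastP)// ler_wpM2r// lerDl.
  by rewrite mulr_ge0// addr_ge0// mulr_ge0// invr_ge0 ltW.
rewrite (le_trans (CP (fun i => a (lift ord_max i)) j))//.
have -> : \sum_(i < n) a (lift ord_max i) *: w i = y - a ord_max *: v.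
  rewrite /y big_ord_recr/= addrK.
  by apply: eq_bigr => k _; rewrite /w widenE.
rewrite mulrDl -mulrA ler_wpDl ?mulr_ge0 ?invr_ge0 ?(ltW d0)// ler_wpM2l//.
rewrite (le_trans (ler_normB _ _))// mulrDl mul1r lerD// normrZ.
by rewrite mulrAC ler_wpM2r.
Qed.


(** A non-trivial relation lets one discard a vector from a spanning family,
    which cannot go on forever. *)
Lemma finite_dimensional_basis (F : numFieldType) (X : lmodType F) :
  finite_dimensional X -> exists (n : nat) (e : 'I_n -> X),
    (forall x : X, exists a : 'I_n -> F, x = \sum_(i < n) a i *: e i) /\
    (forall a : 'I_n -> F, \sum_(i < n) a i *: e i = 0 -> forall i, a i = 0).
Proof.
move=> [n [e]]; elim: n e => [|n IH] e span.
  by exists 0%N, e; split => // a _ [].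
have [indep|] := pselect (forall a : 'I_n.+1 -> F,
  \sum_(i < n.+1) a i *: e i = 0 -> forall i, a i = 0).
  by exists n.+1, e.
move=> /existsNP[a /not_implyP[a0 /existsNP[j aj]]].
have {}aj : a j != 0 by exact/eqP.
apply: (IH (fun i => e (lift j i))) => x; have [b ->] := span x.
exists (fun i => b (lift j i) - b j / a j * a (lift j i)).
under [RHS]eq_bigr do rewrite scalerBl -scalerA.
rewrite sumrB -scaler_sumr (bigD1_ord j)//=.
move: a0; rewrite (bigD1_ord j)//= => /eqP; rewrite addrC addr_eq0 => /eqP ->.
by rewrite scalerN opprK scalerA divfK// addrC.
Qed.

(** The coordinate functionals of a basis are continuous, and finitely many of
    them control the norm. *)
Lemma finite_dimensional_weak_nbhs (R : realType) (s : scalars)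
    (X : normedModType (scalar_field R s)) (x : X) (r : scalar_field R s) :
  finite_dimensional X -> 0 < r ->
  nbhs (x : weak_space X) [set y : X | `|y - x| < r].
Proof.
set F := scalar_field R s.
move=> /finite_dimensional_basis[n [e [span indep]]] r0.
have [C C0 CP] := independent_coord_bound indep.
have [c cP] := choice span.
have c_uniq y a : y = \sum_(i < n) a i *: e i -> c y = a.
  move=> ya; apply/funext => i; apply/eqP; rewrite -subr_eq0; apply/eqP.
  apply: (indep (fun i => c y i - a i)).
  by under eq_bigr do rewrite scalerBl; rewrite sumrB -cP -ya subrr.
have c_lin i : linear (fun y => c y i : F^o).
  move=> k y z; rewrite (c_uniq _ (fun i => k * c y i + c z i))//.
  under eq_bigr do rewrite scalerDl -scalerA.
  by rewrite big_split/= -scaler_sumr -!cP.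
pose phi i : {linear X -> F^o} := HB.pack (fun y => c y i : F^o)
  (GRing.isLinear.Build F X F^o *:%R _ (c_lin i)).
have phi_cts i : continuous (phi i).
  apply: (@linear_bounded_cts _ _ _ _ C) => // y.
  by have := CP (c y) i; rewrite -cP.
pose psi i : dual X := exist _ (phi i) (phi_cts i).
pose S := 1 + \sum_(i < n) `|e i|.
have S0 : 0 < S by rewrite ltr_pwDl// sumr_ge0.
apply/weak_nbhsP; exists n, psi, (r / S); first by rewrite divr_gt0.
move=> y yr; rewrite /= (cP (y - x)) (le_lt_trans (ler_norm_sum _ _ _))//.
apply: (@le_lt_trans _ _ (\sum_(i < n) r / S * `|e i|)).
  apply: ler_sum => i _; rewrite normrZ ler_wpM2r//.
  exact/ltW/yr.
rewrite -mulr_sumr -mulrA gtr_pMr// mulrC ltr_pdivrMr// mul1r.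
by rewrite /S ltrDr.
Qed.

(** Some finite family of vectors is large enough for every [x] to agree with
    one of its combinations on all the forms; if no non-zero vector were killed
    by all the forms, this family would span [X]. *)
Lemma common_kernel (F : numFieldType) (X : lmodType F) n
    (phi : 'I_n -> {linear X -> F^o}) :
  ~ finite_dimensional X -> exists2 x : X, x != 0 & forall i, phi i x = 0.
Proof.
move=> infX; apply: contrapT => ker0; apply: infX.
have span : exists (m : nat) (e : 'I_m -> X), forall x, exists a : 'I_m -> F,
    forall i, phi i (x - \sum_(j < m) a j *: e j) = 0.
  elim: n phi {ker0} => [|n IH] phi.
    exists 0%N, (fun=> 0) => x; exists (fun=> 0) => -[].
    by [].
  have [m [e eP]] := IH (fun i => phi (lift ord_max i)).
  have [inc|] := pselect (forall x, (forall i, phi (lift ord_max i) x = 0) ->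
      phi ord_max x = 0).
    exists m, e => x; have [a aP] := eP x; exists a => i.
    by case: (unliftP ord_max i) => [j ->|->]; [exact: aP|exact: inc].
  move=> /existsNP[v /not_implyP[v0 /eqP vn]].
  exists m.+1, (fun i => if unlift ord_max i is Some j then e j else v) => x.
  have [a aP] := eP x.
  pose y := x - \sum_(j < m) a j *: e j.
  exists (fun i => if unlift ord_max i is Some j then a j
    else phi ord_max y / phi ord_max v) => i.
  rewrite (bigD1_ord ord_max)//= unlift_none.
  under eq_bigr do rewrite !liftK.
  rewrite opprD addrCA -/y addrC linearB linearZ/=.
  case: (unliftP ord_max i) => [j ->|->]; first by rewrite aP v0 scaler0 subr0.
  by rewrite [_ *: _]divfK// subrr.
have [m [e eP]] := span; exists m, e => x; have [a aP] := eP x.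
exists a; apply: contrapT => /eqP; rewrite -subr_eq0 => xa.
by apply: ker0; exists (x - \sum_(i < m) a i *: e i).
Qed.

(** * Bump functions *)

Section continuous_functions.
Context (R : realType) (s : scalars) (K : topologicalType).
Context (cK : compact [set: K]) (hK : hausdorff_space K).
Local Notation F := (scalar_field R s).
Lemma bump_function (t : K) (U : set K) : nbhs t U ->
  exists h : K -> F, [/\ continuous h, h t = 1, forall x, 0 <= h x <= 1 &
    forall x, ~ U x -> h x = 0].
Proof.
have [iota [iota_le iota_onto iota_norm]] := scalar_embedding R s.
move=> nU.
have K1 := hausdorff_accessible hK.
have sepU : uniform_separator [set t] (~` interior U).
  apply: (normal_completely_regular (R := R) (compact_normal hK cK) K1).
    exact/open_closedC/open_interior.
  by move=> /=; apply.
have [f [cf f01 ft fU]] := (@uniform_separatorP _ R _ _).1 sepU.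
(* the separating function is 0 at [t] and 1 off [U] *)
exists (fun x => iota (1 - f x)); split=> [x||x|x Ux].
- apply/cvgrPdist_lt => e e0; have [d dE] := iota_onto _ (ltW e0).
  have d0 : 0 < d.
    by rewrite ltNge -iota_le -dE rmorph0 -real_ltNge ?ger0_real// ltW.
  have /cvgrPdist_lt/(_ _ d0) := cf x.
  apply: filterS => y fxy; rewrite -rmorphB opprB addrC addrA subrK iota_norm.
  rewrite dE lt_neqAle iota_le distrC (ltW fxy) andbT (inj_eq (fmorph_inj iota)).
  by rewrite lt_eqF.
- by rewrite (_ : f t = 0) ?subr0 ?rmorph1//; apply: ft; exists t.
- have : `[0, 1]%classic (f x) by apply: f01; exists x.
  rewrite /= in_itv/= => /andP[f0 f1].
  rewrite -(rmorph0 iota) -(rmorph1 iota) !iota_le subr_ge0 f1/=.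
  by rewrite gerBl.
- rewrite (_ : f x = 1) ?subrr ?rmorph0//; apply: fU; exists x => //.
  by move/interior_subset.
Qed.

(** Only the bound on the sum of the bumps is kept from the disjointness of
    their supports: it is all that sup-norm estimates need. *)
Lemma disjoint_bumps (A : set K) (N : nat) : infinite_set A ->
  exists (t : 'I_N -> K) (h : 'I_N -> K -> F),
    [/\ forall j, A (t j), forall j, continuous (h j), forall j, h j (t j) = 1,
        forall j x, 0 <= h j x <= 1 & forall x, \sum_(j < N) h j x <= 1].
Proof.
move=> infA; have [B BA NB] := infinite_set_fset N infA.
have [x0 _] := infinite_setN0 infA.
pose t (j : 'I_N) := nth x0 (enum_fset B) j.
have NB' (j : 'I_N) : (j < size (enum_fset B))%N.
  exact: leq_trans (ltn_ord j) NB.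
have tI : injective t.
  by move=> i j /eqP; rewrite nth_uniq ?fset_uniq// => /eqP/val_inj.
have [U [nU UI]] := disjoint_nbhs hK tI.
have [h hP] := choice (fun j => bump_function (nU j)).
exists t, h; split=> [j|j|j|j x|x]; try by have [] := hP j.
  by apply: BA; exact: mem_nth.
have [[j Ujx]|noU] := pselect (exists j, U j x); last first.
  rewrite big1 // => j _; have [_ _ _] := hP j; apply => Ujx; apply: noU.
  by exists j.
have [_ _ h01 _] := hP j.
rewrite (bigD1 j)//= big1 ?addr0; first by case/andP: (h01 x).
move=> i ij; have [_ _ _] := hP i; apply => Uix.
by suff : set0 x by []; rewrite -(UI _ _ ij).
Qed.

Context (X : completeNormedModType F).
Local Notation C := (Cspace cK X).

Lemma cmul_continuous (h : K -> F) (u : C) :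
  continuous h -> continuous (fun k => h k *: u k).
Proof. by move=> ch k; apply: cvgZ; [exact: ch|exact: cts_fun]. Qed.

Definition cmul (h : K -> F) (ch : continuous h) (u : C) : C :=
  mkC cK (@cmul_continuous h u ch).

Definition ccst (x : X) : C := mkC cK (fun k => @cst_continuous K X x k).

Lemma le_norm_sup (f : C) k : `|f k| <= `|f|.
Proof. exact: le_Cspace_norm. Qed.

Lemma norm_sup_le (f : C) M : 0 <= M -> (forall k, `|f k| <= M) -> `|f| <= M.
Proof. exact: Cspace_norm_le. Qed.

Lemma addCE (f g : C) k : (f + g) k = f k + g k. Proof. by []. Qed.
Lemma oppCE (f : C) k : (- f) k = - f k. Proof. by []. Qed.
Lemma scaleCE a (f : C) k : (a *: f) k = a *: f k. Proof. by []. Qed.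
Lemma cmulE (h : K -> F) (ch : continuous h) (u : C) k : cmul ch u k = h k *: u k.
Proof. by []. Qed.
Lemma ccstE x k : ccst x k = x. Proof. by []. Qed.
Definition CE := (addCE, oppCE, scaleCE, cmulE, ccstE).

Lemma Csum (I : Type) (r : seq I) (f : I -> C) k :
  (\sum_(i <- r) f i : C) k = \sum_(i <- r) (f i : C) k.
Proof. by elim: r => [|i r IH]; rewrite ?big_nil// !big_cons -IH. Qed.

(** If all of [N] disjoint bumps failed, each of the products [h u] would have
    [|phi (h u)| >= e] for one of the functionals [phi] that define the
    neighbourhood.  Summing, [N e] would be at most the sum of the
    [|phi| |u|] over these functionals, which is absurd for large [N]. *)
Lemma small_bump (A : set K) (z u : C) (U : set C) :
  infinite_set A -> nbhs (z : weak_space C) U ->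
  exists t (h : K -> F) (ch : continuous h),
    [/\ A t, h t = 1, forall x, 0 <= h x <= 1 & U (z + cmul ch u)].
Proof.
move=> infA /weak_nbhsP[n [phi [e e0 eU]]].
have [M MP] := choice (fun i => dual_bounded (phi i)).
have M0 i : 0 <= M i by have [] := MP i.
pose D := (\sum_i M i) * `|u|.
have D0 : 0 <= D by rewrite mulr_ge0// sumr_ge0.
have [|N NP] := @scalar_archi R s (D / e); first by rewrite divr_ge0// ltW.
have [t [h [At ch ht h01 hsum]]] := disjoint_bumps N infA.
apply: contrapT => none.
pose v j := cmul (ch j) u.
have big j : e <= \sum_i `|sval (phi i) (v j)|.
  apply: contrapT => small; apply: none; exists (t j), (h j), (ch j); split => //.
  apply: eU => i; rewrite addrC addKr.
  apply: contrapT => large; apply: small.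
  rewrite (bigD1 i)//= ler_wpDr ?sumr_ge0//.
  by rewrite real_leNgt ?normr_real ?gtr0_real//; exact/negP.
have row i : \sum_j `|sval (phi i) (v j)| <= M i * `|u|.
  (* factors of norm at most 1 that prevent cancellation under [phi i] *)
  pose c j : F := if sval (phi i) (v j) == 0 then 0 else
    `|sval (phi i) (v j)| / sval (phi i) (v j).
  have c1 j : `|c j| <= 1.
    rewrite /c; case: eqP => [|/eqP a0]; first by rewrite normr0.
    by rewrite normrM normfV normr_id divff ?normr_eq0.
  have ca j : `|sval (phi i) (v j)| = c j * sval (phi i) (v j).
    by rewrite /c; case: eqP => [->|/eqP a0]; rewrite ?normr0 ?mul0r// divfK.
  have -> : \sum_j `|sval (phi i) (v j)| = `|sval (phi i) (\sum_j c j *: v j)|.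
    rewrite linear_sum/= -[LHS]ger0_norm ?sumr_ge0//; congr `|_|.
    by apply: eq_bigr => j _; rewrite ca linearZ.
  have [_ /(_ (\sum_j c j *: v j))/le_trans] := MP i; apply.
  rewrite ler_wpM2l//; apply: norm_sup_le => // x.
  rewrite Csum (le_trans (ler_norm_sum _ _ _))//.
  apply: (@le_trans _ _ ((\sum_j h j x) * `|u x|)); last first.
    by rewrite (le_trans _ (le_norm_sup u x))// ler_piMl.
  rewrite mulr_suml; apply: ler_sum => j _ /=.
  rewrite !normrZ mulrA ler_wpM2r//.
  have /andP[hj _] := h01 j x.
  by rewrite (ger0_norm hj) ler_piMl.
suff : D < D by rewrite ltxx.
apply: (@lt_le_trans _ _ (N%:R * e)); first by rewrite -ltr_pdivrMr.
rewrite /D mulr_suml.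
rewrite -[N in N%:R]card_ord mulr_natl -sumr_const.
rewrite (le_trans (ler_sum _ (fun j _ => big j)))// exchange_big/=.
exact: ler_sum.
Qed.

(** The witness is [z - 2 h z] with a bump [h] at a point [t] where [|z t|] is
    almost 1: it stays in the ball as [|1 - 2 h| <= 1], and it differs from [z]
    by [2 z t] at [t]. *)
Lemma super_delta_limit_point (z : C) (k : K) :
  limit_point [set: K] k -> `|z| <= 1 -> `|z k| = 1 -> super_delta z.
Proof.
move=> lk z1 zk U zU e e0.
have e20 : 0 < e / 2 by rewrite divr_gt0.
have nk : nbhs k [set x | `|z k - z x| < e / 2].
  by have /cvgrPdist_lt := @cts_fun _ _ (z : continuousType K X) k; apply.
have infA := limit_point_infinite (hausdorff_accessible hK) lk nk.
have [t [h [ch [[_ At] ht h01 Uy]]]] := small_bump ((-2) *: z) infA zU.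
exists (z + cmul ch ((-2) *: z)); split => //.
  apply: norm_sup_le => // x.
  have -> : (z + cmul ch ((-2) *: z)) x = (1 - h x * 2) *: z x.
    by rewrite !CE scalerA mulrN scalerBl scale1r scaleNr.
  rewrite normrZ mulr_ile1// ?(le_trans (le_norm_sup z x))//.
  have /andP[h0 h1] := h01 x.
  rewrite real_ler_norml ?rpredB ?rpredM ?ger0_real//.
  rewrite gerBl mulr_ge0// andbT.
  by rewrite -subr_ge0 opprK addrAC subr_ge0 ler_piMl.
rewrite opprD addrA subrr add0r normrN.
apply: lt_le_trans (le_norm_sup _ t).
rewrite !CE ht scale1r normrZ normrN normr_nat.
have -> : 2 - e = 2 * (1 - e / 2) :> F.
  by rewrite mulrBr mulr1 mulrCA divff ?mulr1// pnatr_eq0.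
rewrite ltr_pM2l//.
rewrite ltrBlDl -[ltLHS]zk -[X in `|X| < _](subrK (z t)).
rewrite (le_lt_trans (ler_normD _ _))//.
by rewrite ltrD2r.
Qed.

(** The perturbation [f + h (y - f)] is pointwise a convex combination of [f]
    and [y], which keeps it in the unit ball. *)
Lemma bump_towardE (h : K -> F) (ch : continuous h) (f : C) y k :
  (f + cmul ch (ccst y - f)) k = (1 - h k) *: f k + h k *: y.
Proof. by rewrite !CE scalerBr scalerBl scale1r addrA addrAC. Qed.

Lemma bump_toward_le (h : K -> F) (ch : continuous h) (f : C) y :
  (forall k, 0 <= h k <= 1) -> `|f| <= 1 -> `|y| <= 1 ->
  `|f + cmul ch (ccst y - f)| <= 1.
Proof.
move=> h01 f1 y1; apply: norm_sup_le => // k.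
rewrite bump_towardE (le_trans (ler_normD _ _))//.
have /andP[h0 h1] := h01 k.
rewrite !normrZ (ger0_norm h0) ger0_norm ?subr_ge0// -[leRHS](subrK (h k)).
rewrite lerD ?ler_piMr ?subr_ge0//.
by rewrite (le_trans (le_norm_sup f k)).
Qed.

(** Bend the given function towards a unit vector at one of infinitely many
    cluster points; [small_bump] selects a cluster point where this is weakly
    negligible. *)
Lemma weakDD2P_infinite_limit_points (x : X) : x != 0 ->
  infinite_set (limit_point [set: K]) -> weakDD2P C.
Proof.
move=> x0 infK; apply/weakDD2PE => U f oU Uf f1.
have [y y1] : exists y : X, `|y| = 1.
  by exists (`|x|^-1 *: x); rewrite normrZ normfV normr_id mulVf// normr_eq0.
have fU : nbhs (f : weak_space C) U by exact: open_nbhs_nbhs.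
have [t [h [ch [lt ht h01 Uz]]]] := small_bump (ccst y - f) infK fU.
have z1 : `|f + cmul ch (ccst y - f)| <= 1 by apply: bump_toward_le; rewrite ?y1.
exists (f + cmul ch (ccst y - f)); split => //.
apply: (super_delta_limit_point lt z1).
by rewrite bump_towardE ht subrr scale0r add0r scale1r.
Qed.

Lemma eval_linear (k : K) : exists L : {linear C -> X},
  continuous L /\ forall f, L f = f k.
Proof.
have ev_lin : linear (fun f : C => f k) by [].
pose L : {linear C -> X} := HB.pack (fun f : C => f k)
  (GRing.isLinear.Build F C X *:%R _ ev_lin).
exists L; split => //; apply: (@linear_bounded_cts _ _ _ _ 1) => // f.
by rewrite mul1r; exact: le_norm_sup.
Qed.

Lemma eval_weak_continuous (k : K) :
  continuous ((fun f : C => f k) : weak_space C -> weak_space X).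
Proof.
have [L [cL LE]] := eval_linear k.
by apply: (affine_weak_continuous cL) => y z; rewrite LE.
Qed.

Lemma cmul_cst_linear (h : K -> F) (ch : continuous h) :
  (forall k, 0 <= h k <= 1) -> exists L : {linear X -> C},
  continuous L /\ forall x, L x = cmul ch (ccst x).
Proof.
move=> h01; have L_lin : linear (fun x : X => cmul ch (ccst x)).
  by move=> a x y; apply: CspaceP => k; rewrite !CE scalerDr !scalerA mulrC.
pose L : {linear X -> C} := HB.pack (fun x : X => cmul ch (ccst x))
  (GRing.isLinear.Build F X C *:%R _ L_lin).
exists L; split => //; apply: (@linear_bounded_cts _ _ _ _ 1) => // x.
rewrite mul1r; apply: norm_sup_le => // k; rewrite CE normrZ ler_piMl//.
by have /andP[h0 h1] := h01 k; rewrite ger0_norm.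
Qed.

(** The value of [f] at [k0] is pushed to norm 1 in a direction [x] that the
    functionals cannot see.  The bump is supported where [f] is almost equal to
    [f k0], so that replacing [f] by the constant [f k0] there, which keeps the
    result in the ball, is a perturbation small in norm. *)
Lemma weakDD2P_infinite_dimensional (k0 : K) :
  limit_point [set: K] k0 -> ~ finite_dimensional X -> weakDD2P C.
Proof.
move=> lk infX; apply/weakDD2PE => U f oU Uf f1.
have fU : nbhs (f : weak_space C) U by exact: open_nbhs_nbhs.
have /weak_nbhsP[n [phi [e e0 eU]]] := fU.
have [M MP] := choice (fun i => dual_bounded (phi i)).
have M0 i : 0 <= M i by have [] := MP i.
pose S := 1 + \sum_i M i; have S0 : 0 < S by rewrite ltr_pwDl// sumr_ge0.
(* perturbing by at most [e / S] in norm moves no [phi i] by [e] or more *)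
have d0 : 0 < e / S by rewrite divr_gt0.
have /cvgrPdist_lt/(_ _ d0) nk := @cts_fun _ _ (f : continuousType K X) k0.
have [h [ch hk h01 h0]] := bump_function nk.
have [L [cL LE]] := cmul_cst_linear ch h01.
have [x x0 xker] := @common_kernel F X n (fun i => sval (phi i) \o L) infX.
have [c cx] := unit_shift (le_trans (le_norm_sup f k0) f1) x0.
have z1 : `|f + cmul ch (ccst (f k0 + c *: x) - f)| <= 1.
  by apply: bump_toward_le; rewrite ?cx.
exists (f + cmul ch (ccst (f k0 + c *: x) - f)); split => //.
  apply: eU => i; rewrite addrC addKr.
  have -> : cmul ch (ccst (f k0 + c *: x) - f) =
      cmul ch (ccst (f k0) - f) + c *: L x.
    apply: CspaceP => k; rewrite LE !CE scalerA [c * _]mulrC -scalerA -scalerDr.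
    by rewrite addrAC.
  rewrite linearD linearZ; have := xker i => /= ->; rewrite scaler0 addr0.
  have [_ /(_ (cmul ch (ccst (f k0) - f)))/le_lt_trans] := MP i; apply.
  apply: (@le_lt_trans _ _ (M i * (e / S))).
    rewrite ler_wpM2l//; apply: norm_sup_le => [|k]; first exact: ltW.
    rewrite !CE; have [fk|nfk] := pselect (`|f k0 - f k| < e / S).
      have /andP[hk0 hk1] := h01 k.
      by rewrite normrZ ger0_norm// (le_trans _ (ltW fk))// ler_piMl.
    by rewrite h0// scale0r normr0 ltW.
  rewrite mulrCA gtr_pMr// ltr_pdivrMr// mul1r /S (bigD1 i)//= addrCA ltrDl.
  by rewrite ltr_pwDl// sumr_ge0.
apply: (super_delta_limit_point lk z1).
by rewrite bump_towardE hk subrr scale0r add0r scale1r.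
Qed.

(** The weakly open set without super Delta-points consists of the functions
    with norm below 1/2 at the cluster points of [K].  A function [z] in it has
    norm at least 1/2 only on a finite set [S], since a limit point of
    [S] would be a cluster point of [K] at which [|z| >= 1/2]. *)
Lemma not_weakDD2P_finite_dimensional :
  finite_set (limit_point [set: K]) -> finite_dimensional X -> ~ weakDD2P C.
Proof.
move=> finK finX /weakDD2PE dd.
have half0 : 0 < 1 / 2 :> F by rewrite divr_gt0.
have oB (r : F) : open ([set x : X | `|x| < r] : set (weak_space X)).
  rewrite openE => x /= xr; have r0 : 0 < r - `|x| by rewrite subr_gt0.
  apply: filterS (finite_dimensional_weak_nbhs x finX r0) => y /=.
  rewrite ltrBrDr; apply: le_lt_trans.
  by rewrite -[X in `|X| <= _](subrK x) ler_normD.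
have [||| z [Uz z1 zP]] := dd ([set f : C | forall k, limit_point [set: K] k ->
    `|f k| < 1 / 2]) 0.
- apply: (@open_finite (weak_space C) K (limit_point [set: K])
    (fun k => [set f : C | `|f k| < 1 / 2])) => // k _.
  exact: open_comp (fun f _ => @eval_weak_continuous k f) (oB _).
- by move=> k _ /=; rewrite normr0.
- by rewrite normr0.
pose S := [set k | ~ `|z k| < 1 / 2].
have finS : finite_set S.
  apply: contrapT => infS; have [p Sp] := compact_limit_point cK infS.
  have zp : `|z p| < 1 / 2.
    by apply: Uz => V /Sp[y [yp _ Vy]]; exists y.
  have np : 0 < 1 / 2 - `|z p| by rewrite subr_gt0.
  have /cvgrPdist_lt/(_ _ np) nz := @cts_fun _ _ (z : continuousType K X) p.
  have [y [_ Sy]] := Sp _ nz.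
  rewrite /= ltrBrDr => zy; apply: Sy; apply: le_lt_trans zy.
  by rewrite distrC -[X in `|X| <= _](subrK (z p)) ler_normD.
have zV : nbhs (z : weak_space C) [set y : C | forall k, S k -> `|y k - z k| < 1].
  apply: (@near_finite (weak_space C) K S z
    (fun k => [set y : C | `|y k - z k| < 1])) => // k _.
  have nzk := finite_dimensional_weak_nbhs (z k) finX ltr01.
  exact: (@eval_weak_continuous k z _ nzk).
have [y [Vy y1]] := zP _ zV _ half0.
have -> : 2 - 1 / 2 = 1 + 1 / 2 :> F.
  by rewrite -[2]/(1 + 1) -addrA; congr (_ + _); rewrite {1}[1]splitr addrK.
suff : `|z - y| <= 1 + 1 / 2 by move=> /le_lt_trans H /H; rewrite ltxx.
apply: norm_sup_le => [|k]; first by rewrite addr_ge0// ltW.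
rewrite !CE; have [zk|zk] := pselect (`|z k| < 1 / 2).
  rewrite (le_trans (ler_normB _ _))// addrC lerD ?(ltW zk)//.
  by rewrite (le_trans (le_norm_sup y k)).
by rewrite distrC (le_trans (ltW (Vy k zk)))// lerDl ltW.
Qed.

(** The functions equal to [f] off an isolated point [k0] form a copy of [X]
    through [T], which is isometric and weakly continuous, so super Delta-points
    of [X] are carried to super Delta-points. *)
Lemma weakDD2P_isolated (k0 : K) :
  ~ limit_point [set: K] k0 -> weakDD2P X -> weakDD2P C.
Proof.
move=> nlk /weakDD2PE dd; apply/weakDD2PE => U f oU Uf f1.
have [V nV VP] : exists2 V : set K, nbhs k0 V & forall k, V k -> k = k0.
  apply: contrapT => noV; apply: nlk => V nV; apply: contrapT => noy.
  apply: noV; exists V => // k Vk; apply: contrapT => /eqP kk0.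
  by apply: noy; exists k.
have [h [ch hk h01 h0]] := bump_function nV.
have [L [cL LE]] := cmul_cst_linear ch h01.
pose T x := f + cmul ch (ccst x - f).
have Tk x : T x k0 = x by rewrite bump_towardE hk subrr scale0r add0r scale1r.
have T1 x : `|x| <= 1 -> `|T x| <= 1 by exact: bump_toward_le.
have cT : continuous (T : weak_space X -> weak_space C).
  apply: (affine_weak_continuous cL) => y z.
  rewrite LE /T opprD addrACA subrr add0r; apply: CspaceP => k.
  by rewrite !CE -scalerBr opprB addrA subrK.
have Tf : T (f k0) = f.
  apply: CspaceP => k; rewrite /T !CE.
  have [/VP ->|/h0 ->] := pselect (V k); rewrite ?scale0r ?addr0//.
  by rewrite subrr scaler0 addr0.
have [|||z [Uz z1 zP]] := dd (T @^-1` U) (f k0).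
- exact: (@open_comp (weak_space X) (weak_space C) T U (fun x _ => cT x) oU).
- by rewrite /= Tf.
- exact: le_trans (le_norm_sup f k0) f1.
exists (T z); split => //; first exact: T1.
move=> W TW e e0; have [y [Wy y1 ey]] := zP _ (cT _ _ TW) _ e0.
exists (T y); split => //; first exact: T1.
apply: (lt_le_trans ey); rewrite -{1}(Tk z) -{1}(Tk y).
exact: le_norm_sup (T z - T y) k0.
Qed.

(** If no coordinate of [z] were a super Delta-point, each coordinate would have
    a weak neighbourhood on which the distance to it stays below some bound
    less than 2; the product of these neighbourhoods would keep the distance to
    [z] below the largest of finitely many such bounds. *)
Lemma weakDD2P_finite_space : [set: K] !=set0 -> finite_set [set: K] ->
  weakDD2P C -> weakDD2P X.
Proof.
move=> [k0 _] finK /weakDD2PE dd; apply/weakDD2PE => U x oU Ux x1.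
have [|||z [Uz z1 zP]] :=
  dd [set f : C | forall k, [set: K] k -> U (f k)] (ccst x).
- apply: (@open_finite (weak_space C) K setT
    (fun k => [set f : C | U (f k)])) => // k _.
  exact: open_comp (fun f _ => @eval_weak_continuous k f) oU.
- by [].
- by apply: norm_sup_le.
suff [k zk] : exists k, super_delta (z k).
  exists (z k); split => //; first exact: Uz.
  exact: le_trans (le_norm_sup z k) z1.
apply: contrapT => nosd.
have bad k : exists Ve : set X * F, [/\ nbhs (z k : weak_space X) Ve.1, 0 < Ve.2 &
    forall y, Ve.1 y -> `|y| <= 1 -> `|z k - y| <= 2 - Ve.2].
  apply: contrapT => good; apply: nosd; exists k => V nV e e0.
  apply: contrapT => noy; apply: good; exists (V, e); split => // y Vy y1.
  rewrite real_leNgt ?normr_real ?rpredB ?(gtr0_real e0) ?ger0_real//.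
  by apply/negP => ?; apply: noy; exists y.
have [Ve VeP] := choice bad.
have /finite_seqP[r rK] := finK.
have [e e0 er] := @pos_lower_bound F K r (fun k => (Ve k).2)
  (fun k => let: And3 _ p _ := VeP k in p).
have zV : nbhs (z : weak_space C)
    [set y : C | forall k, [set: K] k -> (Ve k).1 (y k)].
  apply: (@near_finite (weak_space C) K setT z
    (fun k => [set y : C | (Ve k).1 (y k)])) => // k _.
  by apply: (@eval_weak_continuous k z); have [] := VeP k.
have [y [Vy y1]] := zP _ zV _ e0.
suff : `|z - y| <= 2 - e by move=> /le_lt_trans H /H; rewrite ltxx.
have le_e k : `|z k - y k| <= 2 - e.
  have [_ _ H] := VeP k.
  rewrite (le_trans (H _ (Vy k I) (le_trans (le_norm_sup y k) y1)))//.
  rewrite lerD2l lerN2 er//.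
  by have : [set` r] k by rewrite -rK.
by apply: norm_sup_le => //; exact: le_trans (le_e k0).
Qed.

End continuous_functions.

Theorem theorem4p4 (R : realType) (s : scalars) (K : topologicalType)
    (K_nonempty : [set: K] !=set0) (K_compact : compact [set: K])
    (K_hausdorff : hausdorff_space K)
    (X : completeNormedModType (scalar_field R s))
    (X_nonzero : exists x : X, x != 0) :
  let K' := cluster_points [set: K] in
  let K'' := cluster_points K' in
  let CKX : completeNormedModType (scalar_field R s) := Cspace K_compact X in
  [/\ (K' = set0 <-> finite_set [set: K]) /\
      (K' = set0 -> (weakDD2P CKX <-> weakDD2P X)),
      K' !=set0 -> finite_set K' ->
        (weakDD2P CKX <-> ~ finite_dimensional X) &
      (infinite_set K' <-> K'' !=set0) /\
      (infinite_set K' -> weakDD2P CKX)].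
Proof.
move=> K' K'' CKX.
have T1 := hausdorff_accessible K_hausdorff.
have K'E : K' = limit_point [set: K] by rewrite /K' /cluster_points setTI.
have K'0 : K' = set0 <-> finite_set [set: K].
  split=> [K'0|finK].
    apply: contrapT => /(compact_limit_point K_compact)[p].
    by rewrite -K'E K'0.
  rewrite K'E -subset0 => p /limit_point_infinite H.
  by have := H setT T1 filterT; rewrite setIT; apply.
split.
- split=> // K'_0; have finK := K'0.1 K'_0.
  split; first exact: weakDD2P_finite_space.
  have [k0 _] := K_nonempty; apply: (weakDD2P_isolated K_hausdorff (k0 := k0)).
  by rewrite -K'E K'_0.
- move=> [k0 K'k0] finK'; split.
    move=> dd finX; move: dd; apply: not_weakDD2P_finite_dimensional => //.
    by rewrite -K'E.
  by apply: (weakDD2P_infinite_dimensional K_hausdorff (k0 := k0)); rewrite -K'E.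
- split; last first.
    have [x x0] := X_nonzero; rewrite K'E.
    exact: weakDD2P_infinite_limit_points x0.
  split=> [infK'|[p [_ K'p]]].
    have [p K'p] := compact_limit_point K_compact infK'.
    exists p; split=> //; rewrite K'E => V /K'p[y [yp _ Vy]].
    by exists y.
  have := limit_point_infinite T1 K'p (@filterT _ _ (nbhs_filter p)).
  by rewrite setIT.
Qed.
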